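(* Let $U$ and $A$ be algebras over a field $k$ and let $H = U\otimes A$ be an algebra structure on the tensor product of the underlying vector spaces of $U$ and $A$ which satisfies $$(u\otimes a)(u'\otimes a') = uu'\otimes aa' \quad\text{whenever } a = 1 \text{ or } u' = 1 .$$ Suppose that $U'$ is a subalgebra of $U$ with $(u\otimes a)\cdot_\chi u' = \chi(a)uu'$ for all $u\in U$, $a\in A$, $\chi\in \mathrm{Alg}(A,k)$, $u'\in U'$, and with $\mathrm{Alg}(U,k)\to \mathrm{Alg}(U',k)$ (restriction) one-one; and suppose that $A'$ is a subalgebra of $A$ with $a'\cdot_\rho (u\otimes a) = \rho(u)a'a$ for all $a'\in A'$, $\rho\in\mathrm{Alg}(U,k)$, $u\in U$, $a\in A$, and with $\mathrm{Alg}(A,k)\to\mathrm{Alg}(A',k)$ (restriction) one-one. Assume also that the irreducible left $U$-modules and the irreducible left $A$-modules are one-dimensional. Then: a) The finite-dimensional irreducible left $H$-modules are the same as the finite-dimensional objects of ${}_H\underline{\mathcal M}$. b) Suppose that $U$ and $A$ are finite-dimensional. Then the function $\mathrm{Alg}(U,k)\times\mathrm{Alg}(A,k)\to \mathrm{Irr}(H)$ given by $(\rho,\chi)\mapsto[L(\rho,\chi)]$ is bijective.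
   Context: Algebras are associative and unital; $\otimes=\otimes_k$; $\mathrm{Alg}(X,k)$ is the set of unital algebra homomorphisms $X\to k$. $U$ and $A$ are regarded as subalgebras of $H$ via $u\mapsto u\otimes 1$ and $a\mapsto 1\otimes a$; thus $H$-modules are $U$- and $A$-modules. $\mathrm{Irr}(H)$ is the set of isomorphism classes of finite-dimensional irreducible left $H$-modules, and $[M]$ is the isomorphism class of $M$. For $\chi\in\mathrm{Alg}(A,k)$, $U_\chi$ is the left $H$-module with underlying space $U$ and action $$(u\otimes a)\cdot_\chi u' = u\,\big((\mathrm{id}_U\otimes\chi)((1\otimes a)(u'\otimes 1))\big).$$ For $\rho\in\mathrm{Alg}(U,k)$, $A_\rho$ is the right $H$-module with underlying space $A$ and action $$a\cdot_\rho(u\otimes a') = \big((\rho\otimes\mathrm{id}_A)((1\otimes a)(u\otimes 1))\big)\,a' .$$ $I(\rho,\chi)$ is the sum of all left $H$-submodules of $U_\chi$ contained in $\mathrm{Ker}\,\rho$, and $L(\rho,\chi)=U_\chi/I(\rho,\chi)$. ${}_H\underline{\mathcal M}$ is the category whose objects are the left $H$-modules $M$ which are generated (as $H$-modules) by some one-dimensional left $A$-submodule $km$ and which have some codimension one left $U$-submodule $N$ such that $(0)$ is the only left $H$-submodule of $M$ contained in $N$; morphisms are left $H$-module maps. *)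

(* Defs.v *)
From HB Require Import structures.
From mathcomp Require Import all_boot all_algebra.
From mathcomp Require Import boolp classical_sets functions.

Set Implicit Arguments.
Unset Strict Implicit.
Unset Printing Implicit Defensive.

Import GRing.Theory.

Local Open Scope ring_scope.
Local Open Scope quotient_scope.

(* Restriction of scalars along f. *)
Definition res_mod (R S : pzRingType) (f : {rmorphism R -> S})
  (M : lmodType S) : Type := M.

Section Restriction.
Variables (R S : pzRingType) (f : {rmorphism R -> S}) (M : lmodType S).
Local Notation res_mod := (res_mod f M).

HB.instance Definition _ := GRing.Zmodule.copy res_mod M.

Definition res_scale (r : R) (m : res_mod) : res_mod := f r *: (m : M).

Fact res_scaleA r s m :
  res_scale r (res_scale s m) = res_scale (r * s) m.
Proof. by rewrite /res_scale scalerA rmorphM. Qed.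

Fact res_scale1 : left_id 1 res_scale.
Proof. by move=> m; rewrite /res_scale rmorph1 scale1r. Qed.

Fact res_scaleDr : right_distributive res_scale +%R.
Proof. by move=> r m n; rewrite /res_scale scalerDr. Qed.

Fact res_scaleDl m : {morph res_scale^~ m : r s / r + s}.
Proof. by move=> r s; rewrite /res_scale rmorphD scalerDl. Qed.

HB.instance Definition _ := GRing.Zmodule_isLmodule.Build R res_mod
  res_scaleA res_scale1 res_scaleDr res_scaleDl.

End Restriction.

Section QuotientModule.
Variables (R : pzRingType) (M : lmodType R) (N : submodClosed M).

Definition mcarrier : {pred M} := fun x => x \in N.
HB.instance Definition _ := GRing.isZmodClosed.Build M mcarrier
  (GRing.submod_closedB (submodClosedP N)).

Definition mquot : Type := Quotient.quot mcarrier.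
HB.instance Definition _ := GRing.Zmodule.on mquot.

Definition mproj (x : M) : mquot := \pi_(Quotient.quot mcarrier) x.

Definition mquot_scale (r : R) (q : mquot) : mquot :=
  mproj (r *: repr (q : Quotient.quot mcarrier)).

Fact mproj_eq x y : (mproj x = mproj y) <-> (x - y \in N).
Proof.
rewrite -[_ \in _]/(x - y \in mcarrier) Quotient.idealrBE.
by split=> [e|/eqP//]; apply/eqP.
Qed.

Fact mproj_surj q : exists x, q = mproj x.
Proof. by exists (repr (q : Quotient.quot mcarrier)); rewrite /mproj reprK. Qed.

Fact mprojD x y : mproj (x + y) = mproj x + mproj y.
Proof. by rewrite /mproj raddfD. Qed.

Fact mquot_scaleE r x : mquot_scale r (mproj x) = mproj (r *: x).
Proof.
apply/mproj_eq; rewrite -scalerBr rpredZ //.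
by apply/mproj_eq; rewrite /mproj reprK.
Qed.

Fact mquot_scaleA r s m :
  mquot_scale r (mquot_scale s m) = mquot_scale (r * s) m.
Proof. by have [x ->] := mproj_surj m; rewrite !mquot_scaleE scalerA. Qed.

Fact mquot_scale1 : left_id 1 mquot_scale.
Proof. by move=> m; have [x ->] := mproj_surj m; rewrite mquot_scaleE scale1r. Qed.

Fact mquot_scaleDr : right_distributive mquot_scale +%R.
Proof.
move=> r m n; have [x ->] := mproj_surj m; have [y ->] := mproj_surj n.
by rewrite -mprojD !mquot_scaleE scalerDr mprojD.
Qed.

Fact mquot_scaleDl m : {morph mquot_scale^~ m : r s / r + s}.
Proof.
by move=> r s; have [x ->] := mproj_surj m; rewrite !mquot_scaleE scalerDl mprojD.
Qed.

HB.instance Definition _ := GRing.Zmodule_isLmodule.Build R mquot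
  mquot_scaleA mquot_scale1 mquot_scaleDr mquot_scaleDl.

End QuotientModule.

Section SumOfSubmodules.
Variables (R : pzRingType) (M : lmodType R) (P : submodClosed M -> Prop).

(* The sum of the submodules satisfying P. *)
Definition msum : {pred M} := fun x =>
  `[< exists2 s : seq M,
        {in s, forall y, exists2 N : submodClosed M, P N & y \in N} &
        x = \sum_(y <- s) y >].

Fact msum_submod_closed : submod_closed msum.
Proof.
split=> [|r x y]; first by apply/asboolP; exists [::]; rewrite // big_nil.
move=> /asboolP[s sP ->] /asboolP[t tP ->]; apply/asboolP.
exists ([seq r *: z | z <- s] ++ t); last first.
  by rewrite big_cat big_map scaler_sumr.
move=> z; rewrite mem_cat => /orP[/mapP[w /sP[N PN wN] ->]|/tP//].
by exists N => //; rewrite rpredZ.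
Qed.

HB.instance Definition _ :=
  GRing.isSubmodClosed.Build R M msum msum_submod_closed.

End SumOfSubmodules.

Section Modules.
Variable R : pzRingType.

Definition irreducible_mod (M : lmodType R) : Prop :=
  (exists x : M, x != 0) /\
  forall N : submodClosed M, N =i pred1 0 \/ N =i predT.

Definition mod_iso (M N : lmodType R) : Prop :=
  exists f : {linear M -> N}, bijective f.

(* Not a [set (lmodType R)]: that would be a universe inconsistency. *)
Definition iso_class (M : lmodType R) : lmodType R -> Prop := mod_iso M.

End Modules.

Section Dimension.
Variable k : fieldType.

Definition has_dim (n : nat) (V : lmodType k) : Prop :=
  inhabited (Vector.axiom n V).

Definition finite_dim (V : lmodType k) : Prop := exists n, has_dim n V.

Definition line (V : lmodType k) (m : V) : {pred V} :=
  fun x => `[< exists c : k, x = c *: m >].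

(* The k-vector space underlying an X-module, via c |-> c%:A. *)
Definition underlying (X : algType k) (M : lmodType X) : lmodType k :=
  res_mod (in_alg X) M.

Definition Alg (X : algType k) : Type := {lrmorphism X -> k^o}.

Section AlgRestriction.
Variables (X : algType k) (S : {pred X}) (X' : subAlgType S) (rho : Alg X).

Definition Alg_restr_fun : X' -> k^o := rho \o (\val : X' -> X).
HB.instance Definition _ := GRing.RMorphism.copy Alg_restr_fun
  ((rho : {rmorphism X -> k^o}) \o (\val : X' -> X)).
HB.instance Definition _ := GRing.Linear.copy Alg_restr_fun
  ((rho : {linear X -> k^o}) \o (\val : X' -> X)).

Definition Alg_restr : Alg X' := Alg_restr_fun : {lrmorphism X' -> k^o}.
End AlgRestriction.

Definition Irr (X : algType k) : Type :=
  {C : lmodType X -> Prop | exists M : lmodType X,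
     [/\ finite_dim (underlying M), irreducible_mod M & C = iso_class M]}.

Definition irr_class (X : algType k) (C : Irr X) : lmodType X -> Prop :=
  sval C.

Definition is_tensor_product (U A T : lmodType k) (t : {bilinear U -> A -> T}) :
    Prop :=
  forall (V : lmodType k) (f : {bilinear U -> A -> V}),
    exists! g : {linear T -> V}, forall u a, g (t u a) = f u a.

End Dimension.

(* An algebra structure on the vector space U ⊗ A, the latter being given by
   its universal property. The unit is not prescribed: [tensM] forces it to be
   [tens 1 1], see [tens11] below. *)
Record tensorAlg (k : fieldType) (U A : algType k) := TensorAlg {
  tensor_alg :> algType k;
  tens : {bilinear U -> A -> tensor_alg};
  tensP : is_tensor_product tens;
  tensM : forall (u u' : U) (a a' : A), a = 1 \/ u' = 1 ->
    tens u a * tens u' a' = tens (u * u') (a * a') }.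

(* U_chi, with the H-action [vact] below. *)
Definition verma (k : fieldType) (U A : algType k) (H : tensorAlg U A)
  (chi : Alg A) : Type := U.

Section TensorAlgTheory.
Variables (k : fieldType) (U A : algType k) (H : tensorAlg U A).
(* Binds tighter than multiplication: u ⊗ a * v ⊗ b is (u ⊗ a) * (v ⊗ b). *)
Local Notation "u ⊗ a" := (tens H u a) (at level 38).

Definition tens_lift (V : lmodType k) (f : {bilinear U -> A -> V}) :
  {linear H -> V} := sval (cid (tensP H f)).

Lemma tens_liftE (V : lmodType k) (f : {bilinear U -> A -> V}) u a :
  tens_lift f (u ⊗ a) = f u a.
Proof. exact: (proj1 (svalP (cid (tensP H f)))). Qed.

Definition comp_tens (V : lmodType k) (g : {linear H -> V}) (u : U) (a : A) : V :=
  g (u ⊗ a).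
Fact comp_tens_bilinear (V : lmodType k) (g : {linear H -> V}) :
  bilinear_for *:%R *:%R (comp_tens g).
Proof.
split=> [a c u v | u c a a']; rewrite /comp_tens.
  by rewrite linearPl linearP.
by rewrite linearPr linearP.
Qed.
HB.instance Definition _ (V : lmodType k) (g : {linear H -> V}) :=
  bilinear_isBilinear.Build k U A V _ _ (comp_tens g) (comp_tens_bilinear g).

Lemma tens_ext (V : lmodType k) (f g : {linear H -> V}) :
  (forall u a, f (u ⊗ a) = g (u ⊗ a)) -> f =1 g.
Proof.
move=> fg.
by have [h [_ hu]] := tensP H (comp_tens g); rewrite -(hu f fg) -(hu g (fun _ _ => erefl)).
Qed.

Lemma tens11 : 1 ⊗ 1 = 1 :> H.
Proof.
have E : ( *%R (1 ⊗ 1) : H -> H) =1 idfun.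
  have lin : linear ( *%R (1 ⊗ 1) : H -> H).
    by move=> c x y; rewrite mulrDr scalerAr.
  pose L : {linear H -> H} :=
    HB.pack ( *%R (1 ⊗ 1) : H -> H) (GRing.isLinear.Build _ _ _ _ _ lin).
  by apply: (@tens_ext H L idfun) => u a /=; rewrite tensM ?mul1r //; left.
by rewrite -[LHS]mulr1 [LHS]E.
Qed.

Definition inclU (u : U) : H := u ⊗ 1.
Definition inclA (a : A) : H := 1 ⊗ a.

Fact inclU_linear : linear inclU.
Proof. by move=> c u v; rewrite /inclU linearPl. Qed.
Fact inclU_monoid_morphism : monoid_morphism inclU.
Proof.
by split=> [|u v]; rewrite /inclU ?tens11 // tensM ?mulr1 //; left.
Qed.
HB.instance Definition _ := GRing.isLinear.Build k U H _ inclU inclU_linear.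
HB.instance Definition _ :=
  GRing.isMonoidMorphism.Build U H inclU inclU_monoid_morphism.

Fact inclA_linear : linear inclA.
Proof. by move=> c u v; rewrite /inclA linearPr. Qed.
Fact inclA_monoid_morphism : monoid_morphism inclA.
Proof.
by split=> [|u v]; rewrite /inclA ?tens11 // tensM ?mulr1 //; right.
Qed.
HB.instance Definition _ := GRing.isLinear.Build k A H _ inclA inclA_linear.
HB.instance Definition _ :=
  GRing.isMonoidMorphism.Build A H inclA inclA_monoid_morphism.

Section LeftModule.
Variable chi : Alg A.

Definition id_chi_fun (u : U) (a : A) : U := (chi a : k) *: u.
Fact id_chi_bilinear : bilinear_for *:%R *:%R id_chi_fun.
Proof.
split=> [a c u v | u c a b]; rewrite /id_chi_fun.
  by rewrite /= scalerDr !scalerA (mulrC c).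
by rewrite linearP scalerDl -scalerA.
Qed.
HB.instance Definition _ :=
  bilinear_isBilinear.Build k U A U _ _ id_chi_fun id_chi_bilinear.

(* id ⊗ chi, with U ⊗ k identified with U. *)
Definition id_chi : {linear H -> U} := tens_lift id_chi_fun.

Definition vact_fun (u' u : U) (a : A) : U :=
  u * id_chi (1 ⊗ a * u' ⊗ 1).
Fact vact_bilinear u' : bilinear_for *:%R *:%R (vact_fun u').
Proof.
split=> [a c u v | u c a b]; rewrite /vact_fun.
  by rewrite mulrDl -scalerAl.
by rewrite linearPr mulrDl -scalerAl linearP mulrDr -scalerAr.
Qed.
HB.instance Definition _ u' :=
  bilinear_isBilinear.Build k U A U _ _ (vact_fun u') (vact_bilinear u').

HB.instance Definition _ := GRing.Zmodule.copy (verma H chi) U.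
Local Notation verma := (verma H chi).

Definition vact (h : H) (u' : verma) : verma := tens_lift (vact_fun u') h.

Lemma vactE u a u' : vact (u ⊗ a) u' = u * id_chi (1 ⊗ a * u' ⊗ 1).
Proof. exact: tens_liftE. Qed.

Lemma id_chiE u a : id_chi (u ⊗ a) = (chi a : k) *: u.
Proof. exact: tens_liftE. Qed.

Let id_chiMl u h : id_chi (u ⊗ 1 * h) = u * id_chi h.
Proof.
have lin1 : linear (fun x : H => id_chi (u ⊗ 1 * x)).
  by move=> c x y; rewrite mulrDr -scalerAr linearP.
have lin2 : linear (fun x : H => u * id_chi x).
  by move=> c x y; rewrite linearP mulrDr -scalerAr.
pose L1 : {linear H -> U} := HB.pack (fun x : H => id_chi (u ⊗ 1 * x))
  (GRing.isLinear.Build _ _ _ _ _ lin1).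
pose L2 : {linear H -> U} := HB.pack (fun x : H => u * id_chi x)
  (GRing.isLinear.Build _ _ _ _ _ lin2).
apply: (@tens_ext U L1 L2) => v a /=.
by rewrite tensM ?mul1r; [rewrite !id_chiE scalerAr | left].
Qed.

Let id_chiMr h a : id_chi (h * 1 ⊗ a) = (chi a : k) *: id_chi h.
Proof.
have lin1 : linear (fun x : H => id_chi (x * 1 ⊗ a)).
  by move=> c x y; rewrite mulrDl -scalerAl linearP.
have lin2 : linear (fun x : H => (chi a : k) *: id_chi x).
  by move=> c x y; rewrite linearP /= scalerDr !scalerA (mulrC c).
pose L1 : {linear H -> U} := HB.pack (fun x : H => id_chi (x * 1 ⊗ a))
  (GRing.isLinear.Build _ _ _ _ _ lin1).
pose L2 : {linear H -> U} := HB.pack (fun x : H => (chi a : k) *: id_chi x)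
  (GRing.isLinear.Build _ _ _ _ _ lin2).
apply: (@tens_ext U L1 L2) => v b /=.
rewrite tensM ?mulr1; last by right.
by rewrite !id_chiE rmorphM /= scalerA mulrC.
Qed.

Let id_chiM h x : id_chi (h * id_chi x ⊗ 1) = id_chi (h * x).
Proof.
have lin1 : linear (fun x : H => id_chi (h * id_chi x ⊗ 1)).
  by move=> c y z; rewrite linearP linearPl mulrDr -scalerAr linearP.
have lin2 : linear (fun x : H => id_chi (h * x)).
  by move=> c y z; rewrite mulrDr -scalerAr linearP.
pose L1 : {linear H -> U} := HB.pack (fun x : H => id_chi (h * id_chi x ⊗ 1))
  (GRing.isLinear.Build _ _ _ _ _ lin1).
pose L2 : {linear H -> U} := HB.pack (fun x : H => id_chi (h * x))
  (GRing.isLinear.Build _ _ _ _ _ lin2).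
apply: (@tens_ext U L1 L2) => u a /=.
have -> : u ⊗ a = u ⊗ 1 * 1 ⊗ a by rewrite tensM ?mulr1 ?mul1r //; left.
rewrite mulrA [RHS]id_chiMr tensM ?mulr1 ?mul1r; last by left.
by rewrite id_chiE linearZl_LR -scalerAr linearZ.
Qed.

Lemma vact_id_chi h u' : vact h u' = id_chi (h * u' ⊗ 1).
Proof.
have lin2 : linear (fun x : H => id_chi (x * u' ⊗ 1)).
  by move=> c y z; rewrite mulrDl -scalerAl linearP.
pose L2 : {linear H -> U} := HB.pack (fun x : H => id_chi (x * u' ⊗ 1))
  (GRing.isLinear.Build _ _ _ _ _ lin2).
apply: (@tens_ext U _ L2) => u a /=.
rewrite [LHS]tens_liftE; apply: etrans (esym (id_chiMl _ _)) _.
by rewrite mulrA tensM ?mulr1 ?mul1r //; left.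
Qed.

Fact vactA g h u' : vact g (vact h u') = vact (g * h) u'.
Proof. by rewrite !vact_id_chi id_chiM mulrA. Qed.

Fact vact1 : left_id 1 vact.
Proof. by move=> u'; rewrite vact_id_chi mul1r id_chiE rmorph1 scale1r. Qed.

Fact vactDr : right_distributive vact +%R.
Proof.
move=> h u v; rewrite !vact_id_chi -raddfD -mulrDr; congr (id_chi (_ * _)).
by rewrite (linearDl (tens H)).
Qed.

Fact vactDl u' : {morph vact^~ u' : g h / g + h}.
Proof. by move=> g h; rewrite !vact_id_chi mulrDl raddfD. Qed.

HB.instance Definition _ := GRing.Zmodule_isLmodule.Build H verma
  vactA vact1 vactDr vactDl.

End LeftModule.

Section RightAction.
Variable rho : Alg U.

Definition rho_id_fun (u : U) (a : A) : A := (rho u : k) *: a.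
Fact rho_id_bilinear : bilinear_for *:%R *:%R rho_id_fun.
Proof.
split=> [a c u v | u c a b]; rewrite /rho_id_fun.
  by rewrite linearP scalerDl -scalerA.
by rewrite /= scalerDr !scalerA (mulrC c).
Qed.
HB.instance Definition _ :=
  bilinear_isBilinear.Build k U A A _ _ rho_id_fun rho_id_bilinear.

(* rho ⊗ id, with k ⊗ A identified with A. *)
Definition rho_id : {linear H -> A} := tens_lift rho_id_fun.

Definition ract_fun (a : A) (u : U) (a' : A) : A :=
  rho_id (1 ⊗ a * u ⊗ 1) * a'.
Fact ract_bilinear a : bilinear_for *:%R *:%R (ract_fun a).
Proof.
split=> [b c u v | u c b b']; rewrite /ract_fun.
  by rewrite linearPl mulrDr -scalerAr linearP mulrDl -scalerAl.
by rewrite mulrDr -scalerAr.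
Qed.
HB.instance Definition _ a :=
  bilinear_isBilinear.Build k U A A _ _ (ract_fun a) (ract_bilinear a).

(* The right H-action on A_rho. *)
Definition ract (a : A) (h : H) : A := tens_lift (ract_fun a) h.

Lemma ractE a u a' : ract a (u ⊗ a') = rho_id (1 ⊗ a * u ⊗ 1) * a'.
Proof. exact: tens_liftE. Qed.

End RightAction.

Section IrreducibleQuotient.
Variables (rho : Alg U) (chi : Alg A).

(* I(rho, chi) *)
Definition max_submod : {pred verma H chi} :=
  msum (fun N : submodClosed (verma H chi) =>
          forall u : U, u \in (N : {pred verma H chi}) -> rho u = 0).
HB.instance Definition _ := GRing.SubmodClosed.on max_submod.

(* L(rho, chi) *)
Definition Lmod : lmodType H := mquot max_submod.

End IrreducibleQuotient.

Definition generated_by_A_line (M : lmodType H) : Prop :=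
  exists m : M,
    [/\ m != 0,
        submod_closed (line (m : underlying M) : {pred res_mod inclA M}) &
        forall N : submodClosed M,
          {subset line (m : underlying M) <= (N : {pred M})} -> N =i predT].

Definition has_core_free_U_hyperplane (M : lmodType H) : Prop :=
  exists N : submodClosed (res_mod inclU M),
    has_dim 1 (underlying (mquot N)) /\
    forall N' : submodClosed M,
      {subset N' <= (N : {pred M})} -> N' =i pred1 0.

(* The objects of the category _H M. *)
Definition in_HM (M : lmodType H) : Prop :=
  generated_by_A_line M /\ has_core_free_U_hyperplane M.

End TensorAlgTheory.

(* Main.v *)
(* A highest weight datum of M consists of an A-eigenvector m of character chi
   and a functional f on M with f (u x) = rho(u) f(x), such that m generates M
   and Ker f contains no nonzero submodule. Since h m = (id ⊗ chi)(h) m and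
   f (h x) = f ((rho ⊗ id)(h) x), the vector m already generates M over U, and
   f is nonzero on every A-eigenvector. By the hypothesis on A',
   f (a' x) = chi(a') f(x) for a' in A', so every A-eigenvector has character
   chi and, f being injective on them, is a multiple of m. If M is
   finite-dimensional, every nonzero submodule contains an A-eigenvector, hence
   m: thus M is irreducible. The kernel of U_chi -> M, u |-> u m, is
   I(rho, chi), so M is L(rho, chi). Finally, by the hypothesis on U', u' m is
   an A-eigenvector for u' in U', hence equals rho(u') m, and any other datum
   (rho', chi', m', f') gives f'(u' m) = rho'(u') f'(m), so that rho' agrees
   with rho on U'. *)
Require Import Defs.
From HB Require Import structures.
From mathcomp Require Import all_boot all_algebra.
From mathcomp Require Import boolp.

Set Implicit Arguments.
Unset Strict Implicit.
Unset Printing Implicit Defensive.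

Import GRing.Theory.

Local Open Scope ring_scope.

(** * Submodules as predicates and as modules; quotient modules *)

Section Submodules.
Variables (R : pzRingType) (M : lmodType R).

Lemma submodClosed_of (S : {pred M}) :
  submod_closed S -> exists N : submodClosed M, (N : {pred M}) = S.
Proof.
move=> Scl.
by exists (HB.pack_for (submodClosed M) S
  (GRing.isSubmodClosed.Build R M S Scl)).
Qed.

Variable N : submodClosed M.

Lemma mproj0 : mproj N 0 = 0.
Proof. by rewrite /mproj raddf0. Qed.

Lemma mprojB x y : mproj N (x - y) = mproj N x - mproj N y.
Proof. by rewrite /mproj raddfB. Qed.

Lemma mprojZ r x : mproj N (r *: x) = r *: mproj N x.
Proof. exact: esym (mquot_scaleE _ _ _). Qed.

Lemma mproj_eq0 x : mproj N x = 0 <-> x \in N.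
Proof. by rewrite -mproj0 mproj_eq subr0. Qed.

Record submod := Submod { submod_val : M; _ : submod_val \in N }.
HB.instance Definition _ := [isSub for submod_val].
HB.instance Definition _ := [Choice of submod by <:].
HB.instance Definition _ := [SubChoice_isSubLmodule of submod by <:].

End Submodules.

(** * Subspaces and quotients of finite-dimensional vector spaces *)

Section FiniteDimension.
Variable k : fieldType.

(** Take [K] of maximal rank among the matrices whose row space lies in [S]. For [x] in [S] the row
    space of [K + x] still lies in [S], so adding [x] cannot raise the rank. *)
Lemma submod_mx n (S : {pred 'rV[k]_n}) :
  submod_closed S -> exists K : 'M_n, forall x, (x \in S) = (x <= K)%MS.
Proof.
move=> Scl; have [N NS] := submodClosed_of Scl; subst S.
pose P r := `[< exists2 K : 'M[k]_n, \rank K = r &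
                  forall x : 'rV_n, (x <= K)%MS -> x \in N >].
have P0 : exists r, P r.
  exists 0%N; apply/asboolP; exists 0; first by rewrite mxrank0.
  by move=> x; rewrite submx0 => /eqP->; rewrite rpred0.
have Pb r : P r -> (r <= n)%N by case/asboolP=> K <- _; exact: rank_leq_row.
case: (ex_maxnP P0 Pb) => r /asboolP[K rK KS] rmax.
exists K => x; apply/idP/idP => [xS|/KS//].
have: P (\rank (K + x)%MS).
  apply/asboolP; exists (K + x)%MS => // y /sub_addsmxP[[u v] /= ->].
  apply: rpredD; first by apply: KS; rewrite submxMl.
  by rewrite [v]mx11_scalar mul_scalar_mx rpredZ.
move/rmax; rewrite -rK => leK.
have /eqmxP eK : (K == K + x)%MS.
  by rewrite -(geq_leqif (mxrank_leqif_eq (addsmxSl K x))).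
by rewrite eK addsmxSr.
Qed.

Variable V : lmodType k.
Hypothesis fdV : finite_dim V.

(** Here [d] is the dimension, read off in coordinates. It lives on bare predicates so that extremal
    choices can range over any family of [k]-subspaces, such as the submodules for a larger
    algebra. *)
Lemma subspace_rank : exists (d : {pred V} -> nat) (b : nat),
  forall S T : {pred V}, submod_closed S -> submod_closed T ->
    {subset S <= T} ->
    (d S <= b)%N /\ ((d T <= d S)%N -> {subset T <= S}).
Proof.
have [n [[g glin [g' gK g'K]]]] := fdV.
pose G : {linear V -> 'rV[k]_n} := HB.pack g (GRing.isLinear.Build _ _ _ _ _ glin).
have g'lin : linear g' by move=> c x y; apply: (can_inj gK); rewrite glin !g'K.
have pK (S : {pred V}) :
    exists K : 'M[k]_n, submod_closed S -> forall x, (x \in S) = (g x <= K)%MS.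
  have [Scl|nScl] := pselect (submod_closed S); last by exists 0.
  have : submod_closed (fun y => g' y \in S).
    case: Scl => S0 SZ; split=> [|c x y xS yS].
      by rewrite -topredE /= -[0]/(0 : 'rV[k]_n) -[0](linear0 G) gK.
    by rewrite -topredE /= g'lin SZ.
  case/submod_mx=> K hK; exists K => _ x.
  by rewrite -hK [RHS]/(g' (g x) \in S) gK.
(* The choice is arbitrary when [S] is not a subspace. *)
pose K S := sval (cid (pK S)).
exists (fun S => \rank (K S)), n => S T Scl Tcl ST; split.
  exact: rank_leq_row.
have hS := svalP (cid (pK S)) Scl; have hT := svalP (cid (pK T)) Tcl.
have KST : (K S <= K T)%MS.
  apply/row_subP => i; have := hT (g' (row i (K S))).
  rewrite g'K => <-; apply: ST; rewrite hS g'K; exact: row_sub.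
move=> dTS x; rewrite hT hS => /submx_trans; apply.
by have := mxrank_leqif_sup KST => /geq_leqif; rewrite dTS => /esym.
Qed.

Lemma minimal_subspace (Q : {pred V} -> Prop) S :
  (forall T, Q T -> submod_closed T) -> Q S ->
  exists2 S', Q S' & forall T, Q T -> {subset T <= S'} -> {subset S' <= T}.
Proof.
move=> Qcl QS; have [d [b db]] := subspace_rank.
pose P r := `[< exists2 T, Q T & d T = r >].
have exP : exists r, P r by exists (d S); apply/asboolP; exists S.
case: (ex_minnP exP) => r /asboolP[S' QS' rS'] rmin; exists S' => // T QT TS'.
apply: (db _ _ (Qcl _ QT) (Qcl _ QS') TS').2.
by rewrite rS' rmin //; apply/asboolP; exists T.
Qed.

Lemma maximal_subspace (Q : {pred V} -> Prop) S :
  (forall T, Q T -> submod_closed T) -> Q S ->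
  exists2 S', Q S' & forall T, Q T -> {subset S' <= T} -> {subset T <= S'}.
Proof.
move=> Qcl QS; have [d [b db]] := subspace_rank.
pose P r := `[< exists2 T, Q T & d T = r >].
have exP : exists r, P r by exists (d S); apply/asboolP; exists S.
have bP r : P r -> (r <= b)%N.
  by case/asboolP=> T QT <-; have [] := db T T (Qcl _ QT) (Qcl _ QT) (fun _ => id).
case: (ex_maxnP exP bP) => r /asboolP[S' QS' rS'] rmax; exists S' => // T QT S'T.
apply: (db _ _ (Qcl _ QS') (Qcl _ QT) S'T).2.
by rewrite rS' rmax //; apply/asboolP; exists T.
Qed.

Lemma finite_dim_surj (W : lmodType k) (f : {linear V -> W}) :
  (forall y, exists x, y = f x) -> finite_dim W.
Proof.
have [n [[g glin [g' gK g'K]]]] := fdV.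
have g'lin : linear g' by move=> c x y; apply: (can_inj gK); rewrite glin !g'K.
pose G' : {linear 'rV[k]_n -> V} := HB.pack g' (GRing.isLinear.Build _ _ _ _ _ g'lin).
pose F : {linear 'rV[k]_n -> W} := f \o G'.
move=> fsurj; have Fsurj y : exists x, y = F x.
  by have [x ->] := fsurj y; exists (g x); rewrite /F /= gK.
have : submod_closed (fun x => F x == 0).
  split=> [|c x y /eqP Fx /eqP Fy]; apply/eqP; first exact: (linear0 F).
  by rewrite [LHS](linearP F) Fx Fy scaler0 addr0.
case/submod_mx=> K kerF.
have kerFE x : (F x == 0) = (x <= K)%MS by rewrite -kerF.
(* The rows of [B] are a basis of a complement of the kernel of [F]; in these coordinates [F]
   becomes an isomorphism [h] onto [W]. *)
pose B := row_base (K^C)%MS.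
pose h (y : 'rV_(\rank K^C)) := F (y *m B).
have hlin : linear h by move=> c x y; rewrite /h mulmxDl -scalemxAl linearP.
have hinj y : h y = 0 -> y = 0.
  move=> hy; apply/eqP.
  have : (y *m B <= K :&: K^C)%MS.
    rewrite sub_capmx -kerFE [F _]hy eqxx /=.
    by rewrite (submx_trans (submxMl _ _)) // eq_row_base.
  by rewrite capmx_compl submx0 mulmx_free_eq0 ?row_base_free.
have hsurj y : exists x, h x = y.
  have [x ->] := Fsurj y.
  have : (x <= K + K^C)%MS.
    by rewrite submx_full // addsmx_compl_full.
  case/sub_addsmxP=> [[u v] /= ->].
  have /submxP[w vw] : (v *m K^C <= B)%MS by rewrite eq_row_base submxMl.
  have /eqP FuK : F (u *m K) == 0 by rewrite kerFE submxMl.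
  by exists w; rewrite vw [RHS](raddfD F) [X in X + _]FuK add0r.
pose h' y := sval (cid (hsurj y)).
have h'K : cancel h' h by move=> y; exact: svalP (cid (hsurj y)).
have Hinj : injective h.
  move=> x y hxy; apply/eqP; rewrite -subr_eq0; apply/eqP/hinj.
  by rewrite /h mulmxBl linearB -!/(h _) hxy subrr.
exists (\rank K^C); split; exists h'; last first.
  by exists h => // x; apply: Hinj; rewrite h'K.
by move=> c x y; apply: Hinj; rewrite hlin !h'K.
Qed.

End FiniteDimension.

(** * Eigenvectors, their characters, and irreducible quotients *)

Section FiniteDimensionalModules.
Variables (k : fieldType) (X : algType k).

Lemma scale_alg_inj (M : lmodType X) (m : M) (c d : k) :
  m != 0 -> c%:A *: m = d%:A *: m :> M -> c = d.
Proof.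
move=> m0 /eqP; rewrite -subr_eq0 -scalerBl -[_ - _]scalerBl => /eqP cdm.
apply/eqP; rewrite -subr_eq0; apply: contraNT m0 => cd0.
rewrite -[m]scale1r -[1](@scale1r k) -(mulVf cd0) -scalerA -mulr_algl -scalerA.
by rewrite cdm scaler0.
Qed.

Lemma scale_algM (M : lmodType X) (m : M) (c d : k) :
  c%:A *: (d%:A *: m) = (c * d)%:A *: m.
Proof. by rewrite scalerA mulr_algl scalerA. Qed.

Lemma scale_algC (M : lmodType X) (m : M) (c : k) (x : X) :
  x *: (c%:A *: m) = c%:A *: (x *: m).
Proof. by rewrite !scalerA mulr_algl mulr_algr. Qed.

Lemma scale_algD (M : lmodType X) (m : M) (c d : k) :
  c%:A *: m + d%:A *: m = (c + d)%:A *: m.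
Proof. by rewrite -!scalerDl. Qed.

(** Since [m != 0], eigenvalues are unique, so the function choosing them inherits linearity and
    multiplicativity from the action. *)
Lemma eigen_char (M : lmodType X) (m : M) :
  m != 0 -> (forall x : X, exists c : k, x *: m = c%:A *: m) ->
  exists chi : Alg X, forall x, x *: m = (chi x : k)%:A *: m.
Proof.
move=> m0 /choice[chi chiP].
have lin : linear (chi : X -> k^o).
  move=> c x y; apply: (scale_alg_inj m0).
  rewrite -chiP scalerDl -[c *: x]mulr_algl -scalerA [x *: m]chiP [y *: m]chiP.
  by rewrite scale_algM scale_algD.
have mon : monoid_morphism (chi : X -> k^o).
  split=> [|x y]; apply: (scale_alg_inj m0); first by rewrite -chiP !scale1r.
  by rewrite -chiP -scalerA [y *: m]chiP scale_algC [x *: m]chiP scale_algM mulrC.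
exists (HB.pack_for (Alg X) (chi : X -> k^o)
  (GRing.isLinear.Build _ _ _ _ _ lin) (GRing.isMonoidMorphism.Build _ _ _ mon)).
exact: chiP.
Qed.

Lemma has_dim1_basis (W : lmodType k) :
  has_dim 1 W -> exists2 e : W, e != 0 & forall x, exists c : k, x = c *: e.
Proof.
case=> [[g glin [g' gK g'K]]].
pose G : {linear W -> 'rV[k]_1} := HB.pack g (GRing.isLinear.Build _ _ _ _ _ glin).
exists (g' 1).
  apply/eqP => e0; have := oner_neq0 'M[k]_1.
  by rewrite -[1]g'K e0 -[g 0]/(G 0) linear0 eqxx.
move=> x; exists (g x 0 0); apply: (can_inj gK).
by rewrite -[RHS]/(G _) linearZ /= g'K -[LHS]mulmx1 {1}[g x]mx11_scalar mul_scalar_mx.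
Qed.

Lemma submod_closed_underlying (M : lmodType X) (N : submodClosed M) :
  submod_closed (N : {pred underlying M}).
Proof.
split=> [|c x y xN yN]; first exact: (rpred0 N).
by apply: (rpredD (V := M)) => //; apply: (rpredZ (V := M)).
Qed.

(** By finite dimension [N] contains a minimal nonzero submodule. It is irreducible, hence
    one-dimensional by hypothesis, and a vector spanning it is an eigenvector. *)
Lemma exists_eigenvector (M : lmodType X) (N : submodClosed M) (y : M) :
  (forall M' : lmodType X, irreducible_mod M' -> has_dim 1 (underlying M')) ->
  finite_dim (underlying M) -> y \in N -> y != 0 ->
  exists (chi : Alg X) (x : M),
    [/\ x \in N, x != 0 & forall a, a *: x = (chi a : k)%:A *: x].
Proof.
move=> irrX fdM yN y0.
pose Q (S : {pred underlying M}) := exists S' : submodClosed M,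
  [/\ (S' : {pred M}) = S, {subset S' <= N} & exists2 x, x \in S' & x != 0].
have Qcl T : Q T -> submod_closed T.
  by case=> [T' [<- _ _]]; exact: submod_closed_underlying.
have QN : Q N by exists N; split=> //; exists y.
have [S [T [TS TN [x xT x0]]] Smin] := minimal_subspace fdM Qcl QN.
subst S.
have irrT : irreducible_mod (submod T).
  split; first by exists (Submod xT).
  move=> P; have [[z zP z0]|nz] := pselect (exists2 z, z \in P & z != 0); last first.
    left=> z; rewrite !inE; apply/idP/eqP => [zP|->]; last exact: rpred0.
    by apply/eqP; apply: contrapT => /negP z0; apply: nz; exists z.
  right=> w; rewrite [RHS]inE.
  (* The image of [P] in [M] is a nonzero submodule inside the minimal [T], hence all of [T]. *)
  pose P' : {pred M} := fun v => `[< exists2 p, p \in P & v = submod_val p >].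
  have P'cl : submod_closed P'.
    split; first by apply/asboolP; exists 0; rewrite ?rpred0.
    move=> a u v /asboolP[p pP ->] /asboolP[q qP ->]; apply/asboolP.
    by exists (a *: p + q); rewrite ?rpredD ?rpredZ.
  have [P'' eP''] := submodClosed_of P'cl.
  have P'T : {subset P'' <= T}.
    by move=> v; rewrite eP'' => /asboolP[p _ ->]; exact: (valP p).
  have QP : Q P''.
    exists P''; split=> // [v /P'T/TN//|].
    by exists (submod_val z) => //; rewrite eP''; apply/asboolP; exists z.
  have := Smin _ QP P'T (submod_val w) (valP w).
  by rewrite eP'' => /asboolP[p pP /val_inj->].
have [e e0 eP] := has_dim1_basis (irrX _ irrT).
have e0' : submod_val e != 0 by apply: contraNneq e0 => ve; apply/eqP/val_inj.
have [|chi chiP] := eigen_char e0'.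
  move=> a; have [c ec] := eP (a *: (e : submod T)); exists c.
  exact: (congr1 (@submod_val _ _ _) ec).
by exists chi, (submod_val e); split=> //; apply: TN; exact: (valP e).
Qed.

(** Divide by a maximal proper submodule; as [M] is nonzero, the zero submodule is a proper one to
    start from. *)
Lemma exists_irreducible_quotient (M : lmodType X) :
  finite_dim (underlying M) -> (exists x : M, x != 0) ->
  exists N : submodClosed M, irreducible_mod (mquot N).
Proof.
move=> fdM [y y0].
pose Q (S : {pred underlying M}) := exists2 S' : submodClosed M,
  (S' : {pred M}) = S & exists x, x \notin S'.
have Qcl T : Q T -> submod_closed T.
  by case=> [T' <- _]; exact: submod_closed_underlying.
have Q0 : Q (pred1 0 : {pred M}).
  have cl0 : submod_closed (pred1 0 : {pred M}).
    split=> [|a u v]; rewrite !inE // => /eqP-> /eqP->.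
    by rewrite scaler0 addr0.
  by have [Z ZE] := submodClosed_of cl0; exists Z; rewrite ?ZE //; exists y.
have [S [N NS [x xN]] Nmax] := maximal_subspace fdM Qcl Q0; subst S.
exists N; split.
  exists (mproj N x); by apply: contra xN => /eqP/mproj_eq0.
move=> P.
(* The preimage of [P] contains [N]. By maximality it is [N], and [P] is zero, or it is not proper,
   and [P] is everything. *)
pose P' : {pred M} := fun v => mproj N v \in P.
have P'cl : submod_closed P'.
  split=> [|a u v uP vP]; first by rewrite -topredE /= /P' mproj0 rpred0.
  by rewrite -topredE /= /P' mprojD mprojZ rpredD // rpredZ.
have [P'' eP''] := submodClosed_of P'cl.
have NP'' : {subset N <= P''}.
  move=> v vN; rewrite eP'' -topredE /= /P'.
  have -> : mproj N v = 0 by apply/mproj_eq0.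
  exact: rpred0.
have [QP|nQ] := pselect (Q P'').
  left=> q; have [v ->] := mproj_surj q; rewrite !inE.
  apply/idP/eqP => [vP|->]; last exact: rpred0.
  apply/mproj_eq0; apply: (Nmax _ QP NP'').
  by rewrite eP''.
right=> q; have [v ->] := mproj_surj q; rewrite [RHS]inE.
apply: contrapT => vP; apply: nQ; exists P'' => //; exists v.
by rewrite eP''; apply/negP.
Qed.

End FiniteDimensionalModules.

Lemma finite_dim_res_mod (k : fieldType) (X Y : algType k)
    (g : {rmorphism X -> Y}) (M : lmodType Y) :
  (forall c : k, g c%:A = c%:A) -> finite_dim (underlying M) ->
  finite_dim (underlying (res_mod g M)).
Proof.
move=> gk [n [[h hlin hbij]]]; exists n; split; exists h => // c x y.
rewrite -hlin; congr (h (_ + _)).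
by rewrite -[LHS]/(g c%:A *: (x : M)) gk.
Qed.

Lemma Alg_ext (k : fieldType) (X : algType k) (f g : Alg X) : f =1 g -> f = g.
Proof.
case: f g => [f [[fa] [fm] [fz]]] [g [[ga] [gm] [gz]]] /= /funext fg; subst g.
congr GRing.LRMorphism.Pack.
by rewrite (Prop_irrelevance fa ga) (Prop_irrelevance fm gm) (Prop_irrelevance fz gz).
Qed.

(** * Weights, coweights and highest weight data *)

Section HighestWeight.
Variables (k : fieldType) (U A : algType k) (H : tensorAlg U A).

Lemma inclU_alg (c : k) : inclU H c%:A = c%:A.
Proof. by rewrite linearZ /= rmorph1. Qed.

Lemma inclA_alg (c : k) : inclA H c%:A = c%:A.
Proof. by rewrite linearZ /= rmorph1. Qed.

Lemma tensE u a : tens H u a = inclU H u * inclA H a.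
Proof. by rewrite tensM ?mulr1 ?mul1r //; left. Qed.

Definition A_weight (chi : Alg A) (M : lmodType H) (m : M) : Prop :=
  forall a, inclA H a *: m = (chi a : k)%:A *: m.

Definition U_coweight (rho : Alg U) (M : lmodType H) (f : {additive M -> k}) :
    Prop :=
  forall u x, f (inclU H u *: x) = (rho u : k) * f x.

(** Additivity of [f] is enough: [hw_coweight] at scalars of [U] makes [f] linear over [k]. In
    [hw_core], cyclic submodules [H x] stand for all submodules inside Ker [f]. *)
Record highest_weight (rho : Alg U) (chi : Alg A) (M : lmodType H) (m : M)
    (f : {additive M -> k}) : Prop := HighestWeight {
  hw_weight : A_weight chi m;
  hw_coweight : U_coweight rho f;
  hw_gen : forall x, exists u, x = inclU H u *: m;
  hw_core : forall x, (forall h : H, f (h *: x) = 0) -> x = 0;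
  hw_neq0 : f m != 0 }.

Lemma coweight_scale rho (M : lmodType H) (f : {additive M -> k}) c x :
  U_coweight rho f -> f (c%:A *: x) = c * f x.
Proof. by move=> fU; rewrite -inclU_alg fU linearZ /= rmorph1 [_ *: _]mulr1. Qed.

(** Both sides are linear in [x], and on a pure tensor [(u a) m = chi(a) u m]. *)
Lemma weight_id_chi chi (M : lmodType H) (m : M) (x : H) :
  A_weight chi m -> x *: m = inclU H (id_chi H chi x) *: m.
Proof.
move=> mA.
have lin1 : linear (fun x : H => x *: m : underlying M).
  by move=> c y z; rewrite scalerDl -mulr_algl -scalerA.
have lin2 : linear (fun x : H => inclU H (id_chi H chi x) *: m : underlying M).
  by move=> c y z; rewrite linearP [inclU H _]linearP /= scalerDl -mulr_algl -scalerA.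
pose L1 : {linear H -> underlying M} := HB.pack (fun x : H => x *: m : underlying M)
  (GRing.isLinear.Build _ _ _ _ _ lin1).
pose L2 : {linear H -> underlying M} :=
  HB.pack (fun x : H => inclU H (id_chi H chi x) *: m : underlying M)
  (GRing.isLinear.Build _ _ _ _ _ lin2).
apply: (@tens_ext _ _ _ H _ L1 L2) => u a /=.
by rewrite id_chiE tensE -scalerA mA linearZ /= scalerA mulr_algr.
Qed.

(** Dual to [weight_id_chi]: on a pure tensor, [f (u a y) = rho(u) f (a y)]. *)
Lemma coweight_rho_id rho (M : lmodType H) (f : {additive M -> k}) (x : H) y :
  U_coweight rho f -> f (x *: y) = f (inclA H (rho_id H rho x) *: y).
Proof.
move=> fU.
have lin1 : linear (fun x : H => f (x *: y) : k^o).
  by move=> c v w; rewrite scalerDl raddfD -mulr_algl -scalerA (coweight_scale _ _ fU).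
have lin2 : linear (fun x : H => f (inclA H (rho_id H rho x) *: y) : k^o).
  move=> c v w; rewrite linearP [inclA H _]linearP /= scalerDl raddfD.
  by rewrite -mulr_algl -scalerA (coweight_scale _ _ fU).
pose L1 : {linear H -> k^o} := HB.pack (fun x : H => f (x *: y) : k^o)
  (GRing.isLinear.Build _ _ _ _ _ lin1).
pose L2 : {linear H -> k^o} :=
  HB.pack (fun x : H => f (inclA H (rho_id H rho x) *: y) : k^o)
  (GRing.isLinear.Build _ _ _ _ _ lin2).
apply: (@tens_ext _ _ _ H _ L1 L2) => u a /=.
rewrite [tens_lift _ _ _]tens_liftE tensE -scalerA fU /rho_id_fun.
by rewrite linearZ /= -mulr_algl -scalerA (coweight_scale _ _ fU).
Qed.

(** This makes [u |-> u m] an [H]-linear map from U_chi to [M]. *)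
Lemma weight_vact chi (M : lmodType H) (m : M) (h : H) (u : U) :
  A_weight chi m -> h *: (inclU H u *: m) = inclU H (h *: (u : verma H chi)) *: m.
Proof.
move=> mA; rewrite scalerA (weight_id_chi _ mA); congr (inclU H _ *: _).
exact: esym (vact_id_chi _ _).
Qed.

Lemma coweight_weight_neq0 rho chi (M : lmodType H) (m : M) (f : {additive M -> k}) :
  U_coweight rho f -> A_weight chi m -> (exists h : H, f (h *: m) != 0) -> f m != 0.
Proof.
move=> fU mA [h]; apply: contraNneq => fm0.
by rewrite (weight_id_chi _ mA) fU fm0 mulr0.
Qed.

(** * Rigidity of weight vectors under the hypotheses on [A'] and [U'] *)

Section TriangularAlgebra.
Variables (SA : {pred A}) (A' : subAlgType SA).
Hypothesis hA' : forall (a' : A') (rho : Alg U) (u : U) (a : A),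
  ract (H := H) rho (\val a') (tens H u a) = (rho u : k) *: (\val a' * a).
Hypothesis A'_inj : injective (@Alg_restr k A SA A').

Section Irreducible.
Variables (rho : Alg U) (chi : Alg A) (M : lmodType H) (m : M).
Variable f : {additive M -> k}.
Hypothesis hw : highest_weight rho chi m f.
Let mA := hw_weight hw.
Let fU := hw_coweight hw.

(** Write [x = u m]. The hypothesis on [A'] turns [f (a' u m)] into [rho(u) f (a' m)], which is
    [chi(a') rho(u) f(m) = chi(a') f(x)]. *)
Lemma coweight_A' (a' : A') x : f (inclA H (\val a') *: x) = (chi (\val a') : k) * f x.
Proof.
have [u ->] := hw_gen hw x.
have /= := hA' a' rho u 1; rewrite ractE !mulr1 => e.
rewrite scalerA (coweight_rho_id _ _ fU) e linearZ /= -mulr_algl -scalerA.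
by rewrite (coweight_scale _ _ fU) mA (coweight_scale _ _ fU) fU mulrCA.
Qed.

Lemma weight_hw_neq0 chi' (x : M) : A_weight chi' x -> x != 0 -> f x != 0.
Proof.
move=> xA x0; apply: (coweight_weight_neq0 fU xA); apply: contrapT => nf.
case/eqP: x0; apply: (hw_core hw) => h; apply: contrapT => /eqP fh.
by apply: nf; exists h.
Qed.

(** Computing [f (a' x)] from the weight of [x] and from [coweight_A'] gives
    [chi'(a') f(x) = chi(a') f(x)], and [f x] cancels. *)
Lemma weight_hw_unique chi' (x : M) : A_weight chi' x -> x != 0 -> chi' = chi.
Proof.
move=> xA x0; apply: A'_inj; apply: Alg_ext => a' /=.
apply: (mulIf (weight_hw_neq0 xA x0)).
by rewrite -[RHS]coweight_A' xA (coweight_scale _ _ fU).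
Qed.

(** The difference of the two sides has weight [chi] and is killed by [f], so it vanishes by
    [weight_hw_neq0]. *)
Lemma weight_hw_line (x : M) : A_weight chi x -> x = (f x / f m)%:A *: m.
Proof.
move=> xA; apply/eqP; rewrite -subr_eq0; apply/negP => /negP d0.
have dA : A_weight chi (x - (f x / f m)%:A *: m).
  move=> a; rewrite !scalerBr xA; congr (_ - _).
  by rewrite scale_algC mA scale_algC.
have := weight_hw_neq0 dA d0.
by rewrite raddfB (coweight_scale _ _ fU) divfK ?(hw_neq0 hw) // subrr eqxx.
Qed.

Lemma hw_irreducible :
  (forall M' : lmodType A, irreducible_mod M' -> has_dim 1 (underlying M')) ->
  finite_dim (underlying M) -> irreducible_mod M.
Proof.
move=> irrA fdM; split.
  by exists m; apply: contraNneq (hw_neq0 hw) => ->; rewrite raddf0.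
move=> N; have [[y yN y0]|nz] := pselect (exists2 y, y \in N & y != 0); last first.
  left=> z; rewrite !inE; apply/idP/eqP => [zN|->]; last exact: rpred0.
  by apply/eqP; apply: contrapT => /negP z0; apply: nz; exists z.
right=> z; rewrite [RHS]inE.
(* Over [A], the nonzero submodule [N] contains an eigenvector [x], which has to be a nonzero
   multiple of [m]. *)
have NAcl : submod_closed (N : {pred res_mod (inclA H) M}).
  split=> [|a v w vN wN]; first exact: (rpred0 N).
  by apply: (rpredD (V := M)) => //; apply: (rpredZ (V := M)).
have [NA eNA] := submodClosed_of NAcl.
have fdMA := finite_dim_res_mod inclA_alg fdM.
have yNA : (y : res_mod (inclA H) M) \in NA by rewrite eNA.
have [chi' [x [xNA x0 xE]]] := exists_eigenvector irrA fdMA yNA y0.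
have xA : A_weight chi' (x : M).
  by move=> a; rewrite -inclA_alg; exact: xE.
have echi := weight_hw_unique xA x0; subst chi'.
have xN : (x : M) \in N by rewrite eNA in xNA.
have fx0 := weight_hw_neq0 xA x0.
have mN : m \in N.
  have -> : m = (f m / f x)%:A *: (x : M).
    rewrite {2}(weight_hw_line xA) scale_algM mulrA divfK ?mulfV ?(hw_neq0 hw) //.
    by rewrite (scale1r (1 : H)) scale1r.
  exact: rpredZ.
by have [u ->] := hw_gen hw z; rewrite rpredZ.
Qed.

End Irreducible.

Variables (SU : {pred U}) (U' : subAlgType SU).
Hypothesis hU' : forall (u : U) (a : A) (chi : Alg A) (u' : U'),
  tens H u a *: (\val u' : verma H chi) = (chi a : k) *: (u * \val u') :> U.
Hypothesis U'_inj : injective (@Alg_restr k U SU U').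

Lemma hw_unique rho rho' chi chi' (M : lmodType H) (m m' : M)
    (f f' : {additive M -> k}) :
  highest_weight rho chi m f -> highest_weight rho' chi' m' f' ->
  rho = rho' /\ chi = chi'.
Proof.
move=> hw hw'; have mA := hw_weight hw.
have m0 : m != 0 by apply: contraNneq (hw_neq0 hw) => ->; rewrite raddf0.
have echi := weight_hw_unique hw' mA m0; split=> //; subst chi'.
have f'm0 := weight_hw_neq0 hw' mA m0.
apply: U'_inj; apply: Alg_ext => u' /=.
(* By the hypothesis on [U'], [a] sends [u'] to [chi(a) u'] in U_chi. *)
have uA : A_weight chi (inclU H (\val u') *: m).
  move=> a; rewrite (weight_vact _ _ mA) hU' mul1r linearZ /=.
  by rewrite [RHS]scalerA mulr_algl.
(* The factor [f (u' m) / f m] is [rho(u')]; applying [f'] to [u' m = rho(u') m] then compares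
   [rho'] with [rho] on [U']. *)
have e := weight_hw_line hw uA.
rewrite (hw_coweight hw) mulfK ?(hw_neq0 hw) // in e.
apply: (mulIf f'm0).
by rewrite -[RHS](hw_coweight hw') e (coweight_scale _ _ (hw_coweight hw')).
Qed.

End TriangularAlgebra.

End HighestWeight.

(** * Isomorphism of modules and isomorphism classes *)

Section ModIso.
Variables (R : pzRingType).

Lemma inj_surj_bij (S T : Type) (g : S -> T) :
  injective g -> (forall y, exists x, g x = y) -> bijective g.
Proof.
move=> ginj /choice[g' g'K]; exists g' => // x.
by apply: ginj; rewrite g'K.
Qed.

Lemma mod_iso_refl (M : lmodType R) : mod_iso M M.
Proof. by exists idfun; exists idfun. Qed.

Lemma mod_iso_sym (M N : lmodType R) : mod_iso M N -> mod_iso N M.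
Proof.
case=> f [f' fK f'K].
have lin : linear f'.
  by move=> c x y; apply: (can_inj fK); rewrite linearP !f'K.
by exists (HB.pack_for {linear N -> M} f' (GRing.isLinear.Build _ _ _ _ _ lin)); exists f.
Qed.

Lemma mod_iso_trans (M N P : lmodType R) :
  mod_iso M N -> mod_iso N P -> mod_iso M P.
Proof.
by move=> [f fbij] [g gbij]; exists (g \o f); exact: bij_comp.
Qed.

Lemma iso_class_eq (M N : lmodType R) : mod_iso M N -> iso_class M = iso_class N.
Proof.
move=> MN; apply: funext => P; apply: propext; split.
  exact/mod_iso_trans/mod_iso_sym.
exact: mod_iso_trans.
Qed.

End ModIso.

(** * Highest weight data on L(rho, chi), on objects of the category and on irreducible modules *)

Section Classification.
Variables (k : fieldType) (U A : algType k) (H : tensorAlg U A).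

Lemma hw_iso_Lmod rho chi (M : lmodType H) (m : M) (f : {additive M -> k}) :
  highest_weight rho chi m f -> mod_iso (Lmod H rho chi) M.
Proof.
move=> hw; have mA := hw_weight hw; have fU := hw_coweight hw.
pose phi (u : verma H chi) : M := inclU H (u : U) *: m.
have philin : linear phi.
  move=> h u v; rewrite /phi (weight_vact _ _ mA) -scalerDl; congr (_ *: _).
  by rewrite -(raddfD (inclU H)).
pose Phi : {linear verma H chi -> M} :=
  HB.pack phi (GRing.isLinear.Build _ _ _ _ _ philin).
have fphi u : f (phi u) = rho u * f m by rewrite fU.
(* The kernel is a submodule inside Ker [rho], as [rho(u) f(m) = f (u m)]. Conversely, for [v] in a
   submodule inside Ker [rho], [f] vanishes on [H (v m)], so [v m = 0]. *)
have kerP u : phi u = 0 <-> u \in @max_submod k U A H rho chi.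
  split=> [phi0|/asboolP[s sP ->]].
    have kercl : submod_closed (fun v => phi v == 0).
      split=> [|h v w /eqP pv /eqP pw]; apply/eqP; first exact: (linear0 Phi).
      by rewrite [LHS]philin pv pw scaler0 addr0.
    have [N eN] := submodClosed_of kercl.
    apply/asboolP; exists [:: u]; last by rewrite big_seq1.
    move=> v; rewrite inE => /eqP->; exists N; last by rewrite eN; apply/eqP.
    move=> w; rewrite eN => /eqP pw; apply: (mulIf (hw_neq0 hw)).
    by rewrite -fphi pw raddf0 mul0r.
  rewrite [LHS](raddf_sum Phi) big_seq big1 // => v /sP[N Nrho vN].
  apply: (hw_core hw) => h.
  rewrite [_ *: _](weight_vact _ _ mA) [LHS]fphi.
  by rewrite Nrho ?mul0r //; apply: (rpredZ (V := verma H chi)).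
pose g (q : Lmod H rho chi) : M :=
  phi (repr (q : Quotient.quot (mcarrier (@max_submod k U A H rho chi)))).
have gE u : g (mproj _ u) = phi u.
  apply/eqP; rewrite -subr_eq0 /g -[_ - _](raddfB Phi); apply/eqP/kerP.
  by apply/mproj_eq; rewrite /mproj reprK.
have glin : linear g.
  move=> h q q'; have [u ->] := mproj_surj q; have [v ->] := mproj_surj q'.
  by rewrite -mprojZ -mprojD !gE philin.
exists (HB.pack_for {linear Lmod H rho chi -> M} g (GRing.isLinear.Build _ _ _ _ _ glin)).
apply: inj_surj_bij => [q q'|x] /=.
  have [u ->] := mproj_surj q; have [v ->] := mproj_surj q'.
  rewrite !gE => e; apply/mproj_eq/kerP.
  by rewrite [LHS](raddfB Phi) /= e subrr.
by have [u ->] := hw_gen hw x; exists (mproj _ (u : verma H chi)); rewrite gE.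
Qed.

(** The datum consists of the class of [1] and the functional induced by [rho], which vanishes on
    I(rho, chi). *)
Lemma Lmod_hw rho chi :
  exists (m : Lmod H rho chi) (f : {additive Lmod H rho chi -> k}),
    highest_weight rho chi m f.
Proof.
pose I := @max_submod k U A H rho chi.
have rhoI (u : verma H chi) : u \in I -> rho u = 0.
  move=> /asboolP[s sP ->]; rewrite [LHS](raddf_sum rho) big_seq big1 // => v /sP[N].
  exact.
pose f (q : Lmod H rho chi) : k := rho (repr (q : Quotient.quot (mcarrier I))).
have fE (u : verma H chi) : f (mproj I u) = rho u.
  apply/eqP; rewrite -subr_eq0 -[_ - _](raddfB rho); apply/eqP/rhoI.
  by apply/mproj_eq; rewrite /mproj reprK.
have fadd : zmod_morphism f.
  move=> q q'; have [u ->] := mproj_surj q; have [v ->] := mproj_surj q'.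
  by rewrite -mprojB [LHS]fE [LHS](raddfB rho) !fE.
pose F : {additive Lmod H rho chi -> k} := HB.pack f (GRing.isZmodMorphism.Build _ _ _ fadd).
have uE (u v : U) : inclU H u *: (v : verma H chi) = u * v.
  by rewrite [LHS]vactE tens11 mul1r id_chiE rmorph1 scale1r.
exists (mproj I (1 : U)), F; split.
- move=> a; rewrite -inclU_alg -!mprojZ uE; congr (mproj _ _).
  rewrite [LHS]vactE -[tens H 1 1]/(inclU H 1) rmorph1 mulr1 id_chiE.
  by rewrite mul1r mulr1.
- move=> u q; have [v ->] := mproj_surj q.
  by rewrite -mprojZ uE [LHS]fE [F _]fE rmorphM.
- move=> q; have [v ->] := mproj_surj q; exists v.
  by rewrite -mprojZ uE mulr1.
- move=> q; have [v ->] := mproj_surj q => fv0; apply/mproj_eq0.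
  (* If the functional vanishes on the orbit of the class of [v], then [H v] is a submodule inside
     Ker [rho], so [v] lies in I(rho, chi). *)
  pose S : {pred verma H chi} :=
    fun w => `[< exists h : H, w = h *: (v : verma H chi) >].
  have Scl : submod_closed S.
    split=> [|h w w' /asboolP[a ->] /asboolP[b ->]]; apply/asboolP.
      by exists 0; rewrite scale0r.
    by exists (h * a + b); rewrite scalerDl scalerA.
  have [N eN] := submodClosed_of Scl.
  apply/asboolP; exists [:: v]; last by rewrite big_seq1.
  move=> _ /[!inE]/eqP->; exists N; last first.
    by rewrite eN; apply/asboolP; exists 1; rewrite scale1r.
  move=> w; rewrite eN => /asboolP[h ->].
  by have := fv0 h; rewrite -mprojZ [LHS]fE.
by rewrite [F _]fE rmorph1 oner_neq0.
Qed.

(** Brings the data of two isomorphic modules onto one module, where [hw_unique] can compare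
    them. *)
Lemma hw_transport rho chi (M N : lmodType H) (n : N) (f : {additive N -> k})
    (g : {linear M -> N}) :
  bijective g -> highest_weight rho chi n f ->
  exists (m : M) (f' : {additive M -> k}), highest_weight rho chi m f'.
Proof.
move=> [g' gK g'K] hw; exists (g' n), (f \o g).
have gE (h : H) x : g (h *: x) = h *: g x by exact: linearZ_LR.
split.
- by move=> a; apply: (can_inj gK); rewrite !gE !g'K (hw_weight hw).
- by move=> u x /=; rewrite gE (hw_coweight hw).
- move=> x; have [u gx] := hw_gen hw (g x); exists u.
  by apply: (can_inj gK); rewrite gE g'K.
- move=> x fx; apply: (can_inj gK); rewrite linear0; apply: (hw_core hw) => h.
  by have := fx h; rewrite /= gE.
by rewrite /= g'K (hw_neq0 hw).
Qed.

(** The stable line gives [m] and [chi]. The one-dimensional [U]-module [M / N] gives [rho] as its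
    character and [f] as its coordinate. *)
Lemma in_HM_hw (M : lmodType H) :
  in_HM M ->
  exists rho chi (m : M) (f : {additive M -> k}), highest_weight rho chi m f.
Proof.
case=> [[m [m0 [_ lcl] gen]] [N [dN core]]].
have em (a : A) : exists c : k,
    a *: (m : res_mod (inclA H) M) = c%:A *: (m : res_mod (inclA H) M).
  have l0 : 0 \in line (m : underlying M).
    by apply/asboolP; exists 0; rewrite scale0r.
  have lm : (m : res_mod (inclA H) M) \in line (m : underlying M).
    by apply/asboolP; exists 1; rewrite scale1r.
  have /asboolP[c ec] := lcl a m 0 lm l0.
  exists c; rewrite -[LHS]addr0 [LHS]ec.
  by rewrite [RHS]/(inclA H c%:A *: (m : M)) inclA_alg.
have [chi chiP] := eigen_char (M := res_mod (inclA H) M) m0 em.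
have mA : A_weight chi m by move=> a; rewrite -inclA_alg; exact: chiP.
have [e e0 /choice[c cE]] := has_dim1_basis dN.
have {}cE q : q = (c q)%:A *: (e : mquot N) by exact: cE.
have eU (u : U) : exists d : k, u *: (e : mquot N) = d%:A *: (e : mquot N).
  by exists (c (u *: (e : mquot N))); exact: cE.
have [rho rhoP] := eigen_char (M := mquot N) e0 eU.
pose f (x : M) := c (mproj N x).
have fadd : zmod_morphism f.
  move=> x y; apply: (scale_alg_inj (M := mquot N) e0).
  rewrite -cE mprojB [mproj N x]cE [mproj N y]cE.
  by rewrite [(f x - f y)%:A]scalerBl scalerBl.
pose F : {additive M -> k} := HB.pack f (GRing.isZmodMorphism.Build _ _ _ fadd).
have FU : U_coweight rho F.
  move=> u x; apply: (scale_alg_inj (M := mquot N) e0).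
  rewrite -cE mulrC -scale_algM -rhoP -scale_algC -cE.
  by rewrite -[in RHS]mprojZ.
have F0 x : F x = 0 -> x \in N.
  move=> Fx; apply/mproj_eq0; rewrite [LHS]cE [c _]Fx.
  by rewrite (scale0r (1 : U)) scale0r.
exists rho, chi, m, F.
have mgen x : exists u, x = inclU H u *: m.
  (* By [weight_vact], [U m] is stable under [H]; containing the generating line, it is all of
     [M]. *)
  pose S : {pred M} := fun x => `[< exists u, x = inclU H u *: m >].
  have Scl : submod_closed S.
    split=> [|h y z /asboolP[u ->] /asboolP[v ->]]; apply/asboolP.
      by exists 0; rewrite rmorph0 scale0r.
    exists ((h *: (u : verma H chi) : U) + v).
    by rewrite (weight_vact _ _ mA) -scalerDl -rmorphD.
  have [S' eS'] := submodClosed_of Scl.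
  have : x \in S'.
    rewrite (gen S') // => _ /asboolP[d ->]; rewrite eS'; apply/asboolP.
    by exists d%:A; rewrite inclU_alg.
  by rewrite eS' => /asboolP.
split=> //.
  move=> x fx0.
  pose S : {pred M} := fun y => `[< exists h : H, y = h *: x >].
  have Scl : submod_closed S.
    split=> [|h y z /asboolP[u ->] /asboolP[v ->]]; apply/asboolP.
      by exists 0; rewrite scale0r.
    by exists (h * u + v); rewrite scalerDl scalerA.
  have [S' eS'] := submodClosed_of Scl.
  have S'N : {subset S' <= (N : {pred M})}.
    by move=> y; rewrite eS' => /asboolP[h ->]; apply: F0.
  have := core S' S'N x; rewrite !inE => xE; apply/eqP; rewrite -xE eS'.
  by apply/asboolP; exists 1; rewrite scale1r.
(* If [f m = 0], then [f] vanishes on [U m = M], so [N = M] and the basis vector [e] of the quotient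
   is zero. *)
apply: contraNneq e0 => Fm0.
have [x ->] := mproj_surj (e : mquot N).
by apply/eqP/mproj_eq0/F0; have [u ->] := mgen x; rewrite FU Fm0 mulr0.
Qed.

(** An [A]-eigenvector generates [M] by irreducibility. For the hyperplane take [N] with [M / N]
    irreducible over [U]: an [H]-submodule inside it is proper, hence zero. *)
Lemma irreducible_in_HM (M : lmodType H) :
  (forall M : lmodType U, irreducible_mod M -> has_dim 1 (underlying M)) ->
  (forall M : lmodType A, irreducible_mod M -> has_dim 1 (underlying M)) ->
  finite_dim (underlying M) -> irreducible_mod M -> in_HM M.
Proof.
move=> irrU irrA fdM [[y y0] irrM]; split.
  have fdMA := finite_dim_res_mod (inclA_alg H) fdM.
  have [T eT] : exists T : submodClosed (res_mod (inclA H) M),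
      (T : {pred _}) = predT.
    exact: submodClosed_of.
  have yT : (y : res_mod (inclA H) M) \in T by rewrite eT.
  have [chi [x [_ x0 xE]]] := exists_eigenvector irrA fdMA yT y0.
  exists x; split=> //.
    split; first by apply/asboolP; exists 0; rewrite scale0r.
    move=> a _ _ /asboolP[c ->] /asboolP[d ->]; apply/asboolP.
    exists (c * (chi a : k) + d).
    have xE' : inclA H a *: (x : M) = (chi a : k)%:A *: (x : M).
      by rewrite -inclA_alg; exact: xE.
    change (inclA H a *: (c%:A *: (x : M)) + d%:A *: (x : M) =
            (c * chi a + d)%:A *: (x : M)).
    by rewrite scale_algC xE' scale_algM scale_algD.
  move=> N xN; case: (irrM N) => // N0; case/eqP: x0.
  apply/eqP; rewrite -[_ == _]/((x : M) \in pred1 0) -N0.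
  by apply: xN; apply/asboolP; exists 1; rewrite scale1r.
have fdMU := finite_dim_res_mod (inclU_alg H) fdM.
have [|N irrN] := exists_irreducible_quotient fdMU; first by exists y.
exists N; split; first exact: irrU.
move=> N' N'N; case: (irrM N') => // N'T.
have [[q q0] _] := irrN; case/eqP: q0.
by have [x ->] := mproj_surj q; apply/mproj_eq0/N'N; rewrite N'T.
Qed.

Lemma finite_dim_Lmod rho chi :
  finite_dim U -> finite_dim (underlying (Lmod H rho chi)).
Proof.
move=> fdU.
pose g (u : U) : underlying (Lmod H rho chi) := mproj _ (u : verma H chi).
have glin : linear g.
  move=> c u v.
  (* Scalars acting on U_chi through [H] agree with those of the vector space [U]. *)
  have cE : c%:A *: (u : verma H chi) = c *: u.
    rewrite -inclU_alg [LHS]vactE tens11 mul1r id_chiE rmorph1 scale1r.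
    by rewrite mulr_algl.
  rewrite /g [RHS]/(c%:A *: mproj _ (u : verma H chi) + mproj _ (v : verma H chi)).
  by rewrite -mprojZ cE; exact: mprojD.
apply: (finite_dim_surj fdU
  (f := HB.pack_for {linear U -> underlying (Lmod H rho chi)} g
          (GRing.isLinear.Build _ _ _ _ _ glin))).
exact: (@mproj_surj _ (verma H chi)).
Qed.

End Classification.

Theorem corollary3p6 (k : fieldType) (U A : algType k) (H : tensorAlg U A)
  (SU : {pred U}) (U' : subAlgType SU)
  (hU' : forall (u : U) (a : A) (chi : Alg A) (u' : U'),
     tens H u a *: (\val u' : verma H chi) = (chi a : k) *: (u * \val u') :> U)
  (U'_inj : injective (@Alg_restr k U SU U'))
  (SA : {pred A}) (A' : subAlgType SA)
  (hA' : forall (a' : A') (rho : Alg U) (u : U) (a : A),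
     ract rho (\val a') (tens H u a) = (rho u : k) *: (\val a' * a))
  (A'_inj : injective (@Alg_restr k A SA A'))
  (irrU : forall M : lmodType U, irreducible_mod M -> has_dim 1 (underlying M))
  (irrA : forall M : lmodType A, irreducible_mod M -> has_dim 1 (underlying M)) :
  (forall M : lmodType H,
     finite_dim (underlying M) /\ irreducible_mod M <->
     finite_dim (underlying M) /\ in_HM M) /\
  (finite_dim U -> finite_dim A ->
   exists L : Alg U * Alg A -> Irr H,
     (forall rho chi, irr_class (L (rho, chi)) = iso_class (Lmod H rho chi)) /\
     bijective L).
Proof.
split=> [M|fdU _].
  split=> -[fdM]; first by move=> irrM; split=> //; exact: irreducible_in_HM.
  case/in_HM_hw=> rho [chi [m [f hw]]]; split=> //.
  exact: (hw_irreducible hA' A'_inj hw).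
have LP (p : Alg U * Alg A) : exists M : lmodType H,
    [/\ finite_dim (underlying M), irreducible_mod M &
        iso_class (Lmod H p.1 p.2) = iso_class M].
  have fdL : finite_dim (underlying (Lmod H p.1 p.2)) by exact: finite_dim_Lmod.
  exists (Lmod H p.1 p.2); split=> //.
  have [m [f hw]] := Lmod_hw H p.1 p.2.
  exact: (hw_irreducible hA' A'_inj hw).
pose L p : Irr H := exist _ (iso_class (Lmod H p.1 p.2)) (LP p).
exists L; split=> //; apply: inj_surj_bij.
  (* Equal classes yield an isomorphism, along which the second datum is pulled back to the first
     module. *)
  move=> [rho chi] [rho' chi'] /(congr1 (@irr_class _ _)) /= eL.
  have [g gbij] : mod_iso (Lmod H rho chi) (Lmod H rho' chi').
    rewrite -[mod_iso _ _]/(iso_class (Lmod H rho chi) _) eL.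
    exact: mod_iso_refl.
  have [m [f hw]] := Lmod_hw H rho chi.
  have [m0 [f0 hw0]] := Lmod_hw H rho' chi'.
  have [m' [f' hw']] := hw_transport gbij hw0.
  by have [-> ->] := hw_unique hA' A'_inj hU' U'_inj hw hw'.
(* Surjectivity: an irreducible module lies in the category, so it carries a datum and is the
   corresponding L(rho, chi). *)
move=> [C CP]; have [M [fdM irrM eC]] := CP.
have [rho [chi [m [f hw]]]] := in_HM_hw (irreducible_in_HM irrU irrA fdM irrM).
exists (rho, chi); apply: eq_exist => /=; rewrite eC.
exact/iso_class_eq/(hw_iso_Lmod hw).
Qed.
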